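(* Let $\phi(x)=-\frac1{|x|}$, $x\in\mathbf{R}^{N}$, $\mathbf{x}=(t,x^\top)^\top$, $\mathbf{M}=\operatorname{diag}(-1,\mathrm{I}_{N})$, $\mathbf{A}(\mathbf{x})=(-\phi(x),0,\dots,0)^\top\in\mathbf{R}^{N+1}$, $$\mathbb{L}^{\text{1st}}(\mathbf{x}_n,\mathbf{x}_{n+1},h)=\frac12\frac{(\mathbf{x}_{n+1}-\mathbf{x}_n)^\top\mathbf{M}(\mathbf{x}_{n+1}-\mathbf{x}_n)}{h^2}+\mathbf{A}^\top(\mathbf{x}_n)\frac{\mathbf{x}_{n+1}-\mathbf{x}_n}{h},$$ and $\mathbb{L}^*(\mathbf{x}_n,\mathbf{x}_{n+1},h)=\mathbb{L}^{\text{1st}}(\mathbf{x}_{n+1},\mathbf{x}_n,-h)$. Then the variational integrators deduced from $$\mathbb{L}^{\text{2nd}}(\mathbf{x}_n,\mathbf{x}_{n+1},h)=\tfrac12\mathbb{L}^*\big(\mathbf{x}_n,\mathbf{x}_{n+1/2},\tfrac h2\big)+\tfrac12\mathbb{L}^{\text{1st}}\big(\mathbf{x}_{n+1/2},\mathbf{x}_{n+1},\tfrac h2\big)$$ and from $$\mathbb{L}^{\text{2nd}}(\mathbf{x}_n,\mathbf{x}_{n+1},h)=\tfrac12\mathbb{L}^{\text{1st}}\big(\mathbf{x}_n,\mathbf{x}_{n+1/2},\tfrac h2\big)+\tfrac12\mathbb{L}^*\big(\mathbf{x}_{n+1/2},\mathbf{x}_{n+1},\tfrac h2\big)$$ are equivalent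 to $$\Phi_h^{\text{2nd}}=\phi_{H_{N}}^{h/2}\circ\cdots\circ\phi_{H_1}^{h/2}\circ\phi_{H_t}^{h}\circ\phi_{H_1}^{h/2}\circ\cdots\circ\phi_{H_{N}}^{h/2}$$ and $$\Phi_h^{\text{2nd}}=\phi_{H_t}^{h/2}\circ\phi_{H_1}^{h/2}\circ\cdots\circ\phi_{H_{N}}^{h}\circ\cdots\circ\phi_{H_1}^{h/2}\circ\phi_{H_t}^{h/2},$$ respectively.
   Context: This concerns the relativistic Kepler system in proper time $\tau$: $\frac{dt}{d\tau}=\gamma$, $\frac{dx}{d\tau}=u$, $\frac{d\gamma}{d\tau}=-\nabla\phi(x)\cdot u$, $\frac{du}{d\tau}=-\gamma\nabla\phi(x)$. The maps act on $(t,x,\gamma,u)$ with $x,u\in\mathbf{R}^N$, $\mathbf{e}_i$ the $i$-th standard basis vector of $\mathbf{R}^N$: $\phi_{H_t}^h:\ (t,x,\gamma,u)\mapsto(t+h\gamma,\ x,\ \gamma,\ u-h\gamma\nabla\phi(x))$; $\phi_{H_i}^h:\ (t,x,\gamma,u)\mapsto(t,\ x+hu_i\mathbf{e}_i,\ \gamma-[\phi(x+hu_i\mathbf{e}_i)-\phi(x)],\ u)$, $i=1,\dots,N$. All points are assumed to avoid $x=0$. The variational integrator of $\mathbb{L}^{\text{2nd}}$ is given by stationarity of the action $h\sum_n\mathbb{L}^{\text{2nd}}$ with respect to all interior points, including the intermediate points $\mathbf{x}_{n+1/2}$ (so the partial derivative of $\mathbb{L}^{\text{2nd}}$ with respect to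 $\mathbf{x}_{n+1/2}$ vanishes). Set $\mathbf{v}_n=-h\frac{\partial\mathbb{L}^{\text{2nd}}}{\partial\mathbf{x}_n}-\mathbf{A}(\mathbf{x}_n)$ and $\mathbf{v}_{n+1}=h\frac{\partial\mathbb{L}^{\text{2nd}}}{\partial\mathbf{x}_{n+1}}-\mathbf{A}(\mathbf{x}_{n+1})$ (partial derivatives of $\mathbb{L}^{\text{2nd}}(\mathbf{x}_n,\mathbf{x}_{n+1},h)$ with $\mathbf{x}_{n+1/2}$ fixed), and write $\mathbf{v}_n=(-\gamma_n,u_n^\top)^\top$. Equivalence to a one-step map $\Psi_h$ means that these relations define precisely the map $(t_n,x_n,\gamma_n,u_n)\mapsto(t_{n+1},x_{n+1},\gamma_{n+1},u_{n+1})=\Psi_h(t_n,x_n,\gamma_n,u_n)$. *)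

(* Defs.v *)
From HB Require Import structures.
From mathcomp Require Import all_boot all_order all_algebra.
From mathcomp Require Import all_classical all_reals all_analysis.
Set Implicit Arguments.
Unset Strict Implicit.
Unset Printing Implicit Defensive.
Import Order.TTheory GRing.Theory Num.Theory.
Import numFieldNormedType.Exports.
Local Open Scope ring_scope.

(* The library norm `|x| on matrices is the sup norm, not the Euclidean one. *)
Definition norm2 (R : realType) (N : nat) (x : 'cV[R]_N) : R :=
  Num.sqrt (\sum_i x i 0 ^+ 2).

Definition phi (R : realType) (N : nat) (x : 'cV[R]_N) : R := - (norm2 x)^-1.

(* 'D_v f is a total operator; it is meaningful where f is derivable. *)
Definition grad (R : realType) (N : nat) (f : 'cV[R]_N -> R) (x : 'cV[R]_N) :
    'cV[R]_N :=
  \col_i 'D_(delta_mx i 0) f x.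

(* All partial derivatives exist at x and vanish. *)
Definition stationary (R : realType) (N : nat) (f : 'cV[R]_N -> R)
    (x : 'cV[R]_N) : Prop :=
  forall i, is_derive x (delta_mx i 0) f 0.

(* A space-time point (t, x^T)^T is a column vector in R^(1 + N). *)
Definition spacetime (R : realType) (N : nat) (t : R) (x : 'cV[R]_N) :
    'cV[R]_(1 + N) :=
  col_mx t%:M x.

Definition Mmx (R : realType) (N : nat) : 'M[R]_(1 + N) :=
  block_mx (-1)%:M 0 0 1%:M.

Definition Apot (R : realType) (N : nat) (p : 'cV[R]_(1 + N)) :
    'cV[R]_(1 + N) :=
  spacetime (- phi (dsubmx p)) 0.

Definition L1st (R : realType) (N : nat) (p q : 'cV[R]_(1 + N)) (h : R) : R :=
  2^-1 * (((q - p)^T *m Mmx R N *m (q - p)) 0 0 / h ^+ 2)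
  + ((Apot p)^T *m (h^-1 *: (q - p))) 0 0.

Definition Lstar (R : realType) (N : nat) (p q : 'cV[R]_(1 + N)) (h : R) : R :=
  L1st q p (- h).

(* The second-order Lagrangians, with the intermediate point m = x_{n+1/2} as
   an explicit argument. *)
Definition L2nd_star_first (R : realType) (N : nat)
    (p m q : 'cV[R]_(1 + N)) (h : R) : R :=
  2^-1 * Lstar p m (h / 2) + 2^-1 * L1st m q (h / 2).

Definition L2nd_first_star (R : realType) (N : nat)
    (p m q : 'cV[R]_(1 + N)) (h : R) : R :=
  2^-1 * L1st p m (h / 2) + 2^-1 * Lstar m q (h / 2).

Record state (R : realType) (N : nat) := State {
  time : R;
  pos : 'cV[R]_N;
  gam : R;
  vel : 'cV[R]_N }.

Definition point (R : realType) (N : nat) (s : state R N) : 'cV[R]_(1 + N) :=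
  spacetime (time s) (pos s).

Definition momentum (R : realType) (N : nat) (s : state R N) :
    'cV[R]_(1 + N) :=
  spacetime (- gam s) (vel s).

Definition flow_t (R : realType) (N : nat) (h : R) (s : state R N) :
    state R N :=
  let: State t x g u := s in
  State (t + h * g) x g (u - (h * g) *: grad (@phi R N) x).

Definition flow_x (R : realType) (N : nat) (h : R) (i : 'I_N)
    (s : state R N) : state R N :=
  let: State t x g u := s in
  let x' := x + (h * u i 0) *: delta_mx i 0 in
  State t x' (g - (phi x' - phi x)) u.

(* [:: f1; ...; fk] stands for the composition f1 \o ... \o fk, so that the
   last map of the list is applied first. *)
Definition compose (T : Type) (fs : seq (T -> T)) (s : T) : T :=
  foldr (fun f a => f a) s fs.

(* The maps are only defined off the singularity x = 0: all the states met
   while applying fs to s, including s and the final one, must avoid it. *)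
Definition collision_free (R : realType) (N : nat)
    (fs : seq (state R N -> state R N)) (s : state R N) : Prop :=
  forall k, (k <= size fs)%N -> pos (compose (drop k fs) s) != 0.

(* phi_{H_N}^{h/2} o ... o phi_{H_1}^{h/2} o phi_{H_t}^h
   o phi_{H_1}^{h/2} o ... o phi_{H_N}^{h/2} *)
Definition Phi2nd_xtx (R : realType) (N : nat) (h : R) :
    seq (state R N -> state R N) :=
  let sweep := [seq flow_x (h / 2) i | i <- enum 'I_N] in
  rev sweep ++ flow_t h :: sweep.

(* phi_{H_t}^{h/2} o phi_{H_1}^{h/2} o ... o phi_{H_{N-1}}^{h/2} o phi_{H_N}^h
   o phi_{H_{N-1}}^{h/2} o ... o phi_{H_1}^{h/2} o phi_{H_t}^{h/2}
   with N = n.+1: only the last spatial map has the full step h. *)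
Definition Phi2nd_txt (R : realType) (n : nat) (h : R) :
    seq (state R n.+1 -> state R n.+1) :=
  let sweep :=
    [seq flow_x (h / 2) (widen_ord (leqnSn n) i) | i <- enum 'I_n] in
  flow_t (h / 2) :: sweep ++ flow_x h ord_max :: rev sweep
    ++ [:: flow_t (h / 2)].

(* L p m q h for p = x_n, m = x_{n+1/2}, q = x_{n+1} *)
Definition lagrangian (R : realType) (N : nat) : Type :=
  'cV[R]_(1 + N) -> 'cV[R]_(1 + N) -> 'cV[R]_(1 + N) -> R -> R.

Definition action (R : realType) (N : nat) (L : lagrangian R N) (h : R)
    (K : nat) (x m : nat -> 'cV[R]_(1 + N)) : R :=
  h * \sum_(k < K) L (x k) (m k) (x k.+1) h.

Definition stationary_action (R : realType) (N : nat) (L : lagrangian R N) (h : R)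
    (K : nat) (x m : nat -> 'cV[R]_(1 + N)) : Prop :=
  (forall k, (0 < k < K)%N ->
     stationary (fun y => action L h K [eta x with k |-> y] m) (x k)) /\
  (forall k, (k < K)%N ->
     stationary (fun y => action L h K x [eta m with k |-> y]) (m k)).

(* The states s 0, ..., s K form a discrete trajectory of the variational
   integrator with intermediate points m 0, ..., m K.-1.  The m k need no condition of avoiding
   the singularity: in L2nd_star_first, the relation for v k places m k at a
   state met by Phi2nd_xtx, and L2nd_first_star does not evaluate phi at m k. *)
Definition variational_trajectory (R : realType) (N : nat) (L : lagrangian R N) (h : R)
    (K : nat) (s : nat -> state R N) (m : nat -> 'cV[R]_(1 + N)) : Prop :=
  let x k := point (s k) in
  let v k := momentum (s k) in
  stationary_action L h K x m /\
  forall k, (k < K)%N ->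
    v k = - h *: grad (fun p => L p (m k) (x k.+1) h) (x k) - Apot (x k) /\
    v k.+1 = h *: grad (fun q => L (x k) (m k) q h) (x k.+1) - Apot (x k.+1).

(* K = 1 is the statement for a single step. *)
Definition integrator_equivalent (R : realType) (N : nat) (L : lagrangian R N) (h : R)
    (fs : seq (state R N -> state R N)) : Prop :=
  forall (K : nat) (s : nat -> state R N),
    (forall k, (k <= K)%N -> pos (s k) != 0) ->
    (forall k, (k < K)%N -> collision_free fs (s k)) ->
    (exists m : nat -> 'cV[R]_(1 + N), variational_trajectory L h K s m) <->
    (forall k, (k < K)%N -> s k.+1 = compose fs (s k)).

(* Main.v *)
Require Import Defs.
From mathcomp Require Import all_boot all_order all_algebra.
From mathcomp Require Import all_classical all_reals all_analysis.
From mathcomp Require Import ring.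
Import Order.TTheory GRing.Theory Num.Theory.
Import numFieldNormedType.Exports.
Local Open Scope ring_scope.

(** Write p = x_n, m = x_{n+1/2}, q = x_{n+1}.  L1st sees the potential only at
    its first point and its adjoint only at the second one.  Hence
    L2nd_star_first, in both of its halves, sees the potential at m only, and
    L2nd_first_star sees it at p and at q but not at m.  The gradients of L2nd
    in its three slots are therefore explicit, each with at most one occurrence
    of the gradient of phi ([star_first_grad_p] to [first_star_grad_m]).

    On the other side, the maps phi_{H_i} leave u unchanged, so a whole sweep
    of them is a translation of x along u in which the changes of potential
    telescope ([drift], [compose_sweep]).  The two compositions thus become
    drift - kick - drift and kick - drift - kick, with a kick by phi_{H_t}
    ([compose_xtx], [compose_txt]).

    For one step, the momentum relation at x_n determines m, stationarity at m
    determines x_{n+1}, and the momentum relation at x_{n+1} determines the new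
    momentum.  These equations are linear in the unknowns once the values and
    gradients of phi are treated as given, and solving them yields exactly the
    drift - kick - drift and the kick - drift - kick formulas
    ([star_first_step], [first_star_step]).

    The passage to trajectories ([integrator_equivalent_step]) rests on the fact
    that a variation of one point only affects the terms of the action which
    contain it, and that at an interior point x_k the difference of the two
    momentum relations for v_k is the discrete Euler-Lagrange equation. *)

(** * Gradients by partial derivatives *)

(** A directional derivative only sees the restriction of a function to a line,
    so it can be moved between functions on different spaces which agree on
    lines.  This one principle gives translations, projections, and the
    reduction to functions of one real variable. *)
Lemma is_derive_line {R : realType} {V V' W : normedModType R}
    {f : V -> W} {g : V' -> W} {a v : V} {a' v' : V'} {d : W} :
  (forall s : R, f (s *: v + a) = g (s *: v' + a')) ->
  is_derive a v f d -> is_derive a' v' g d.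
Proof.
move=> fg.
have E : (fun s : R => s^-1 *: ((f \o shift a) (s *: v) - f a)) =
         (fun s : R => s^-1 *: ((g \o shift a') (s *: v') - g a')).
  apply: funext => s /=; rewrite fg.
  by have /[!scale0r] /[!add0r] -> := fg 0.
by case=> df Df; split; [rewrite /derivable -E | rewrite /derive -E].
Qed.

Lemma is_derive_quadratic {R : realType} (a b c : R) :
  is_derive (0 : R) 1 (fun s => a + s * b + s * s * c) b.
Proof.
have i0 := is_derive_id (0 : R) 1.
have sb := is_deriveM i0 (is_derive_cst b (0 : R) (1 : R)).
have ssc := is_deriveM (is_deriveM i0 i0) (is_derive_cst c (0 : R) (1 : R)).
have a_sb := is_deriveD (is_derive_cst a (0 : R) (1 : R)) sb.
apply: is_derive_eq (is_deriveD a_sb ssc) _.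
by rewrite /GRing.scale /=; ring.
Qed.

(** Unlike [grad], which is total, this also asserts that the partial
    derivatives exist. *)
Definition has_grad {R : realType} {N : nat} (f : 'cV[R]_N -> R)
    (x g : 'cV[R]_N) : Prop :=
  forall i, is_derive x (delta_mx i 0) f (g i 0).

Section Calculus.
Context {R : realType} {N : nat}.
Implicit Types (f : 'cV[R]_N -> R) (x y g v w : 'cV[R]_N).

Lemma grad_unique {f x g} : has_grad f x g -> grad f x = g.
Proof.
by move=> fg; apply/colP => i; rewrite mxE; apply: derive_val; apply: fg.
Qed.

Lemma stationaryE f x : stationary f x <-> has_grad f x 0.
Proof. by split=> H i; have := H i; rewrite mxE. Qed.

Lemma has_grad_unique {f x g g'} : has_grad f x g -> has_grad f x g' -> g = g'.
Proof. by move=> /grad_unique <- /grad_unique. Qed.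

Lemma has_grad_cst (c : R) x : has_grad (fun=> c) x 0.
Proof. by move=> i; rewrite mxE; exact: is_derive_cst. Qed.

Lemma has_gradD {f f' x g g'} : has_grad f x g -> has_grad f' x g' ->
  has_grad (fun y => f y + f' y) x (g + g').
Proof. by move=> ? ? i; rewrite mxE; apply: is_deriveD. Qed.

Lemma has_gradZ c {f x g} : has_grad f x g ->
  has_grad (fun y => c * f y) x (c *: g).
Proof. by move=> ? i; rewrite mxE; apply: is_deriveZ. Qed.

Lemma has_gradM {f f' x g g'} : has_grad f x g -> has_grad f' x g' ->
  has_grad (fun y => f y * f' y) x (f x *: g' + f' x *: g).
Proof. by move=> ? ? i; rewrite !mxE; apply: is_deriveM. Qed.

Lemma has_grad_line {f f' x x' g} :
  (forall y, f (y + x) = f' (y + x')) -> has_grad f x g -> has_grad f' x' g.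
Proof. by move=> ff' fg i; apply: (is_derive_line _ (fg i)) => s. Qed.

Lemma has_grad_linear w x : has_grad (fun y => (w^T *m y) 0 0) x w.
Proof.
move=> i; apply: (@is_derive_line R R _ R
  (fun s => (w^T *m x) 0 0 + s * w i 0 + s * s * 0) _ 0 1).
  move=> s; rewrite mulmxDr -scalemxAr !mxE addr0 /GRing.scale /= mulr1.
  rewrite mulr0 addr0 addrC; congr (_ + _ * _).
  rewrite (bigD1 i) //= !mxE !eqxx mulr1 big1 ?addr0 //.
  by move=> j /negbTE ji; rewrite !mxE ji mulr0.
exact: is_derive_quadratic.
Qed.

(** Along the direction e the quadratic form is a polynomial of degree 2 in the
    parameter, and symmetry of S merges the two cross terms. *)
Lemma has_grad_quadratic (S : 'M[R]_N) x : S^T = S ->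
  has_grad (fun y => (y^T *m S *m y) 0 0) x (2 *: (S *m x)).
Proof.
move=> Ssym i; set e := delta_mx i 0.
apply: (@is_derive_line R R _ R (fun s => (x^T *m S *m x) 0 0 +
  s * (2 * (S *m x) i 0) + s * s * (e^T *m S *m e) 0 0) _ 0 1).
  move=> s; rewrite /GRing.scale /= mulr1 addr0.
  have Sxe : x^T *m S *m e = e^T *m S *m x.
    rewrite [LHS]mx11_scalar -tr_scalar_mx -mx11_scalar.
    by rewrite !trmx_mul trmxK Ssym mulmxA.
  have Sx : (S *m x) i 0 = (e^T *m S *m x) 0 0.
    rewrite -mulmxA; move: (S *m x) => z.
    rewrite [RHS]mxE (bigD1 i) //= !mxE !eqxx mul1r big1 ?addr0 //.
    by move=> j /negbTE ji; rewrite !mxE ji mul0r.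
  have -> : (s *: e + x)^T = s *: e^T + x^T by rewrite linearP.
  rewrite Sx !mulmxDl !mulmxDr -!scalemxAl -!scalemxAr Sxe.
  by rewrite !mxE; ring.
have := is_derive_quadratic ((x^T *m S *m x) 0 0) (2 * (S *m x) i 0)
  ((e^T *m S *m e) 0 0).
by rewrite !mxE.
Qed.

Lemma sum_sqr_gt0 x : x != 0 -> 0 < \sum_i x i 0 ^+ 2.
Proof.
move=> x0; rewrite lt_neqAle sumr_ge0 ?andbT => [|i _]; last exact: sqr_ge0.
apply: contraNneq x0 => /esym /eqP.
rewrite psumr_eq0 => [|i _]; last exact: sqr_ge0.
move=> /allP H; apply/eqP/colP => i; rewrite mxE.
by have := H i (mem_index_enum i); rewrite /= sqrf_eq0 => /eqP.
Qed.

Lemma has_grad_sum_sqr x : has_grad (fun y => \sum_i y i 0 ^+ 2) x (2 *: x).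
Proof.
have := @has_grad_quadratic 1%:M x (trmx1 _ _); rewrite mul1mx.
apply: has_grad_line => y; rewrite mulmx1 mxE.
by apply: eq_bigr => i _; rewrite !mxE.
Qed.

(** Off the origin the radicand stays positive, so along each coordinate line
    phi is a composition of differentiable functions of one variable. *)
Lemma has_grad_phi x : x != 0 -> has_grad (@phi R N) x (grad (@phi R N) x).
Proof.
move=> x0 i; rewrite mxE; apply: derivableP.
set e := delta_mx i 0; pose psi (s : R) := \sum_j (s *: e + x) j 0 ^+ 2.
have psi0 : 0 < psi 0 by rewrite /psi scale0r add0r; exact: sum_sqr_gt0.
have dpsi : is_derive (0 : R) 1 psi ((2 *: x) i 0).
  apply: is_derive_line (has_grad_sum_sqr x i) => s.
  by rewrite addr0 /GRing.scale /= mulr1.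
have sqrt0 : (Num.sqrt \o psi) 0 != 0 by rewrite /= sqrtr_eq0 -ltNge.
have dphi := is_deriveN (is_deriveV sqrt0
  (is_derive1_comp (is_derive1_sqrt psi0) dpsi)).
have line_phi s : (- (fun t => (Num.sqrt (psi t))^-1)) (s *: 1 + 0) =
    phi (s *: e + x).
  by rewrite addr0 opprfctE /phi /norm2 /psi /GRing.scale /= mulr1.
have H := is_derive_line line_phi dphi.
exact: ex_derive.
Qed.
End Calculus.

(** * Space-time vectors and the first-order Lagrangian *)

Section Spacetime.
Context {R : realType} {N : nat}.
Implicit Types (p q y : 'cV[R]_(1 + N)) (x : 'cV[R]_N) (a s t h : R).

Lemma spacetimeD s t x x' :
  spacetime s x + spacetime t x' = spacetime (s + t) (x + x').
Proof. by rewrite /spacetime add_col_mx -raddfD. Qed.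

Lemma spacetimeZ a t x : a *: spacetime t x = spacetime (a * t) (a *: x).
Proof. by rewrite /spacetime scale_col_mx scale_scalar_mx. Qed.

Lemma spacetimeN t x : - spacetime t x = spacetime (- t) (- x).
Proof. by rewrite -scaleN1r spacetimeZ mulN1r scaleN1r. Qed.

Lemma spacetimeM t x : Mmx R N *m spacetime t x = spacetime (- t) x.
Proof.
rewrite /Mmx /spacetime mul_block_col !mul0mx addr0 add0r mul1mx.
by rewrite -scalar_mxM mulN1r.
Qed.

Lemma spacetime_inj s t x x' :
  spacetime s x = spacetime t x' -> s = t /\ x = x'.
Proof.
by case/eq_col_mx=> /matrixP /(_ 0 0); rewrite !mxE eqxx !mulr1n.
Qed.

Lemma spacetimeP p : {t & {x | p = spacetime t x}}.
Proof.
by exists (usubmx p 0 0), (dsubmx p); rewrite /spacetime -mx11_scalar vsubmxK.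
Qed.

Lemma spacetime0 : 0 = spacetime 0 (0 : 'cV[R]_N).
Proof. by rewrite /spacetime raddf0 col_mx0. Qed.

Lemma Mmx_sym : (Mmx R N)^T = Mmx R N.
Proof. by rewrite /Mmx tr_block_mx !trmx0 !tr_scalar_mx. Qed.

Lemma Apot_spacetime t x : Apot (spacetime t x) = spacetime (- phi x) 0.
Proof. by rewrite /Apot col_mxKd. Qed.

(** The direction [spacetime 1 0] is the time axis: A points along it, and
    pairing with it reads off the time coordinate. *)
Lemma ApotE p : Apot p = - phi (dsubmx p) *: spacetime 1 0.
Proof. by rewrite spacetimeZ mulr1 scaler0. Qed.

Lemma mul_spacetime10 t x : ((spacetime 1 0)^T *m spacetime t x) 0 0 = t.
Proof.
rewrite /spacetime tr_col_mx mul_row_col trmx0 mul0mx addr0 tr_scalar_mx mul1mx.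
by rewrite mxE eqxx.
Qed.

Lemma has_grad_potential p : dsubmx p != 0 ->
  has_grad (fun y => phi (dsubmx y)) p
    (spacetime 0 (grad (@phi R N) (dsubmx p))).
Proof.
move=> p0 i; case: (@split_ordP 1 N i) => j ->; rewrite /spacetime.
  rewrite col_mxEu mxE mul0rn.
  apply: is_derive_line (is_derive0 (@phi R N) (dsubmx p)) => s.
  congr phi; rewrite linearD linearZ /=; congr (_ *: _ + _).
  by apply/colP => k; rewrite !mxE eq_rlshift.
rewrite col_mxEd; apply: is_derive_line (has_grad_phi _ p0 j) => s.
congr phi; rewrite linearD linearZ /=; congr (_ *: _ + _).
by apply/colP => k; rewrite !mxE eq_rshift.
Qed.

(** In its second argument L1st is a quadratic form plus a linear form, hence
    differentiable everywhere. *)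
Lemma has_grad_L1st_r p q h :
  has_grad (fun y => L1st p y h) q
    (h ^- 2 *: (Mmx R N *m (q - p)) + h^-1 *: Apot p).
Proof.
have Q : has_grad (fun y => ((y - p)^T *m Mmx R N *m (y - p)) 0 0) q
    (2 *: (Mmx R N *m (q - p))).
  apply: has_grad_line (has_grad_quadratic _ (q - p) Mmx_sym) => y.
  by rewrite addrA.
have P : has_grad (fun y => ((Apot p)^T *m (h^-1 *: (y - p))) 0 0) q
    (h^-1 *: Apot p).
  have := has_grad_linear (h^-1 *: Apot p) (q - p); apply: has_grad_line => y.
  by rewrite addrA -scalemxAr !linearZ -scalemxAl.
have := has_gradD (has_gradZ (2^-1 * h ^- 2) Q) P.
rewrite scalerA mulrAC mulVf ?pnatr_eq0 // mul1r.
apply: has_grad_line => y; rewrite /L1st; congr (_ + _).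
by rewrite -mulrA; congr (_ * _); rewrite mulrC.
Qed.

(** The first argument also enters through A, so a force term appears and the
    singularity has to be avoided.  Only the time component of A is nonzero,
    which leaves the elapsed time as the factor of the force. *)
Lemma has_grad_L1st_l p q h : dsubmx p != 0 ->
  has_grad (fun y => L1st y q h) p
    (- (h ^- 2 *: (Mmx R N *m (q - p))) - h^-1 *: Apot p
     - spacetime 0 ((h^-1 * ((spacetime 1 0)^T *m (q - p)) 0 0) *:
                    grad (@phi R N) (dsubmx p))).
Proof.
move=> p0.
have Q : has_grad (fun y => ((q - y)^T *m Mmx R N *m (q - y)) 0 0) p
    (2 *: (Mmx R N *m (p - q))).
  apply: has_grad_line (has_grad_quadratic _ (p - q) Mmx_sym) => y.
  by rewrite addrA -[q - _]opprB [(- _)^T]linearN !mulNmx mulmxN opprK.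
have T : has_grad (fun y => ((spacetime 1 0)^T *m (q - y)) 0 0) p
    (- spacetime 1 0).
  have := has_grad_linear (- spacetime 1 0) (p - q); apply: has_grad_line => y.
  by rewrite addrA -[q - _]opprB [(- spacetime _ _)^T]linearN mulNmx mulmxN.
have P := has_gradZ (- h^-1) (has_gradM (has_grad_potential _ p0) T).
have := has_gradD (has_gradZ (2^-1 * h ^- 2) Q) P.
rewrite scalerA mulrAC mulVf ?pnatr_eq0 // mul1r.
set g := (X in has_grad _ _ X -> _); set g' := (X in _ -> has_grad _ _ X).
have -> : g = g'.
  rewrite /g /g' -[p - q]opprB mulmxN scalerN -addrA; congr (_ + _).
  rewrite ApotE; move: (q - p) => d; case: (spacetimeP d) => t [x ->].
  rewrite mul_spacetime10 !(spacetimeN, spacetimeD, spacetimeZ).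
  by congr spacetime; [ring | apply/colP => k; rewrite !mxE; ring].
apply: has_grad_line => y; rewrite /L1st; congr (_ + _).
  by rewrite -mulrA; congr (_ * _); rewrite mulrC.
by rewrite ApotE !linearZ /= -!scalemxAl -?scalemxAr !mxE; ring.
Qed.

Definition spacetimeE := (spacetimeN, spacetimeD, spacetimeZ, spacetimeM,
  Apot_spacetime, mul_spacetime10, @col_mxKd R 1 N 1).
End Spacetime.

(** * Gradients of the second-order Lagrangians *)

(** The shape of both L2nd: the mean of two half-step Lagrangians. *)
Lemma has_grad_mean {R : realType} {N : nat} {f g : 'cV[R]_N -> R}
    {x df dg d : 'cV[R]_N} :
  has_grad f x df -> has_grad g x dg -> 2^-1 *: df + 2^-1 *: dg = d ->
  has_grad (fun y => 2^-1 * f y + 2^-1 * g y) x d.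
Proof. by move=> df' dg' <-; apply: has_gradD; apply: has_gradZ. Qed.

Section Gradients.
Context {R : realType} {N : nat}.
Context (h : R) (h0 : h != 0).
Context (t0 tm t1 : R) (x0 xm x1 : 'cV[R]_N).
Let p := spacetime t0 x0.
Let m := spacetime tm xm.
Let q := spacetime t1 x1.

Lemma star_first_grad_p :
  has_grad (fun y => L2nd_star_first y m q h) p
    (spacetime (2 / h ^+ 2 * (tm - t0) + phi xm / h)
               (- (2 / h ^+ 2) *: (xm - x0))).
Proof.
apply: (has_grad_mean (has_grad_L1st_r _ _ _) (has_grad_cst _ _)).
rewrite scaler0 addr0 !spacetimeE.
by congr spacetime; [field | apply/colP => i; rewrite !mxE; field].
Qed.

Lemma star_first_grad_q :
  has_grad (fun y => L2nd_star_first p m y h) q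
    (spacetime (- (2 / h ^+ 2 * (t1 - tm)) - phi xm / h)
               ((2 / h ^+ 2) *: (x1 - xm))).
Proof.
apply: (has_grad_mean (has_grad_cst _ _) (has_grad_L1st_r _ _ _)).
rewrite scaler0 add0r !spacetimeE.
by congr spacetime; [field | apply/colP => i; rewrite !mxE; field].
Qed.

Lemma star_first_grad_m : xm != 0 ->
  has_grad (fun y => L2nd_star_first p y q h) m
    (spacetime (2 / h ^+ 2 * (t1 - tm - (tm - t0)))
       ((2 / h ^+ 2) *: (xm - x0 - (x1 - xm))
        - ((t1 - t0) / h) *: grad (@phi R N) xm)).
Proof.
move=> xm0; have dm : dsubmx m != 0 by rewrite col_mxKd.
apply: (has_grad_mean (has_grad_L1st_l _ _ _ dm)
  (has_grad_L1st_l _ _ _ dm)).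
rewrite !spacetimeE.
by congr spacetime; [field | apply/colP => i; rewrite !mxE; field].
Qed.

Lemma first_star_grad_p : x0 != 0 ->
  has_grad (fun y => L2nd_first_star y m q h) p
    (spacetime (2 / h ^+ 2 * (tm - t0) + phi x0 / h)
       (- (2 / h ^+ 2) *: (xm - x0)
        - ((tm - t0) / h) *: grad (@phi R N) x0)).
Proof.
move=> x00; have dp : dsubmx p != 0 by rewrite col_mxKd.
apply: (has_grad_mean (has_grad_L1st_l _ _ _ dp) (has_grad_cst _ _)).
rewrite scaler0 addr0 !spacetimeE.
by congr spacetime; [field | apply/colP => i; rewrite !mxE; field].
Qed.

Lemma first_star_grad_q : x1 != 0 ->
  has_grad (fun y => L2nd_first_star p m y h) q
    (spacetime (- (2 / h ^+ 2 * (t1 - tm)) - phi x1 / h)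
       ((2 / h ^+ 2) *: (x1 - xm)
        - ((t1 - tm) / h) *: grad (@phi R N) x1)).
Proof.
move=> x10; have dq : dsubmx q != 0 by rewrite col_mxKd.
apply: (has_grad_mean (has_grad_cst _ _) (has_grad_L1st_l _ _ _ dq)).
rewrite scaler0 add0r !spacetimeE.
by congr spacetime; [field | apply/colP => i; rewrite !mxE; field].
Qed.

Lemma first_star_grad_m :
  has_grad (fun y => L2nd_first_star p y q h) m
    (spacetime (2 / h ^+ 2 * (t1 - tm - (tm - t0)) + (phi x1 - phi x0) / h)
       ((2 / h ^+ 2) *: (xm - x0 - (x1 - xm)))).
Proof.
apply: (has_grad_mean (has_grad_L1st_r _ _ _) (has_grad_L1st_r _ _ _)).
rewrite !spacetimeE.
by congr spacetime; [field | apply/colP => i; rewrite !mxE; field].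
Qed.
End Gradients.

(** * The splitting maps as drifts and kicks *)

Section Drift.
Context {R : realType} {N : nat}.
Implicit Types (x d : 'cV[R]_N) (s : state R N) (h : R).

(** Displacement at constant u that conserves gam + phi.  These maps compose by
    adding displacements, unlike the flow_x, whose steps lie along the axes. *)
Definition drift d s : state R N :=
  let: State t x g u := s in State t (x + d) (g - (phi (x + d) - phi x)) u.

Lemma flow_xE h i s : flow_x h i s = drift ((h * vel s i 0) *: delta_mx i 0) s.
Proof. by case: s. Qed.

Lemma drift0 s : drift 0 s = s.
Proof. by case: s => t x g u; rewrite /drift addr0 subrr subr0. Qed.

Lemma drift_comp d d' s : drift d (drift d' s) = drift (d' + d) s.
Proof. by case: s => t x g u; rewrite /drift addrA; congr State; ring. Qed.

Lemma vel_drift d s : vel (drift d s) = vel s.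
Proof. by case: s. Qed.

Lemma compose_cons (T : Type) (f : T -> T) (fs : seq (T -> T)) (a : T) :
  compose (f :: fs) a = f (compose fs a).
Proof. by []. Qed.

Lemma compose_cat (T : Type) (fs gs : seq (T -> T)) (a : T) :
  compose (fs ++ gs) a = compose fs (compose gs a).
Proof. exact: foldr_cat. Qed.

(** Since u is constant along the maps phi_{H_i}, they commute and their
    displacements add, while the differences of phi telescope. *)
Lemma compose_sweep (I : Type) (r : seq I) (e : I -> 'I_N) h s :
  compose [seq flow_x h (e i) | i <- r] s =
  drift (h *: \sum_(i <- r) vel s (e i) 0 *: delta_mx (e i) 0) s.
Proof.
elim: r => [|i r IH]; first by rewrite big_nil scaler0 drift0.
rewrite map_cons compose_cons IH flow_xE drift_comp vel_drift big_cons.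
by rewrite scalerDr scalerA addrC.
Qed.

Lemma sum_delta_col x : \sum_i x i 0 *: delta_mx i 0 = x.
Proof.
rewrite [RHS]matrix_sum_delta; apply: eq_bigr => i _.
by rewrite big_ord1.
Qed.

Lemma compose_full_sweep h s :
  compose [seq flow_x h i | i <- enum 'I_N] s = drift (h *: vel s) s.
Proof. by rewrite (compose_sweep _ _ id) big_enum /= sum_delta_col. Qed.

Lemma compose_full_sweep_rev h s :
  compose (rev [seq flow_x h i | i <- enum 'I_N]) s = drift (h *: vel s) s.
Proof.
by rewrite -map_rev (compose_sweep _ _ id) big_rev big_enum /= sum_delta_col.
Qed.

Lemma compose_xtx h s :
  compose (@Phi2nd_xtx R N h) s =
  let s' := flow_t h (drift ((h / 2) *: vel s) s) in
  drift ((h / 2) *: vel s') s'.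
Proof.
rewrite /Phi2nd_xtx compose_cat compose_full_sweep_rev compose_cons.
by rewrite compose_full_sweep.
Qed.

End Drift.

(** The two half-step sweeps over the first n axes and the full step along the
    last axis add up to the full displacement h u. *)
Lemma compose_txt {R : realType} {n : nat} (h : R) (s : state R n.+1) :
  compose (@Phi2nd_txt R n h) s =
  let s' := flow_t (h / 2) s in flow_t (h / 2) (drift (h *: vel s') s').
Proof.
rewrite /Phi2nd_txt compose_cons compose_cat compose_cons compose_cat.
rewrite -map_rev; set s' := compose [:: _] s; rewrite -[flow_t _ s]/s'.
rewrite !compose_sweep flow_xE !drift_comp !vel_drift; congr flow_t.
rewrite big_rev !big_enum /=; congr drift.
rewrite -[in RHS](sum_delta_col (vel s')) big_ord_recr /=.
by apply/colP => i; rewrite !mxE; field.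
Qed.

(** * From single steps to trajectories *)

Section Trajectories.
Context {R : realType} {N : nat}.
Context (L : lagrangian R N) (h : R) (h0 : h != 0).

Definition variational_step (s : state R N) (m : 'cV[R]_(1 + N))
    (s' : state R N) : Prop :=
  [/\ stationary (fun y => L (Defs.point s) y (Defs.point s') h) m,
      momentum s = - h *: grad (fun p => L p m (Defs.point s') h) (Defs.point s)
                   - Apot (Defs.point s)
    & momentum s' = h *: grad (fun q => L (Defs.point s) m q h) (Defs.point s')
                    - Apot (Defs.point s')].

Lemma has_grad_affine c (f : 'cV[R]_(1 + N) -> R) x g :
  has_grad f x g -> has_grad (fun y => h * f y + c) x (h *: g).
Proof.
move=> fg; rewrite -[h *: g]addr0.
exact: has_gradD (has_gradZ h fg) (has_grad_cst c x).
Qed.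

(** What is needed to read a stationarity condition for the action off the
    terms which depend on the varied point. *)
Lemma stationary_affine c (f : 'cV[R]_(1 + N) -> R) x :
  stationary (fun y => h * f y + c) x <-> stationary f x.
Proof.
rewrite !stationaryE; split=> [H|/(has_grad_affine c)]; last by rewrite scaler0.
have := has_gradD (has_gradZ h^-1 H) (has_grad_cst (- (h^-1 * c)) x).
rewrite scaler0 addr0; apply: has_grad_line => y.
by rewrite mulrDr mulKf // addrK.
Qed.

(** The intermediate points are independent of each other: m_k occurs in one
    term of the action. *)
Lemma action_midpoint K x m k : (k < K)%N -> exists c, forall y,
  action L h K x [eta m with k |-> y] = h * L (x k) y (x k.+1) h + c.
Proof.
move=> kK; exists (h * \sum_(j < K | j != Ordinal kK) L (x j) (m j) (x j.+1) h).
move=> y; rewrite /action (bigD1 (Ordinal kK)) //= eqxx mulrDr.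
congr (_ + h * _); apply: eq_bigr => j jk.
by suff /negbTE -> : (j : nat) != k by [].
Qed.

(** An interior point occurs in the terms before and after it, which gives the
    discrete Euler-Lagrange equation. *)
Lemma action_point K x m k : (k.+1 < K)%N -> exists c, forall y,
  action L h K [eta x with k.+1 |-> y] m =
  h * (L (x k) (m k) y h + L y (m k.+1) (x k.+2) h) + c.
Proof.
move=> kK; pose j1 := Ordinal kK; pose j0 := Ordinal (ltnW kK).
exists (h * \sum_(j < K | (j != j0) && (j != j1)) L (x j) (m j) (x j.+1) h).
move=> y; rewrite /action (bigD1 j0) //= (bigD1 j1) /=; last first.
  by rewrite -val_eqE /= eqn_leq ltnn.
rewrite eqxx !eqSS [k == _]eqn_leq ltnn andbF [k.+1 == _]eqn_leq ltnn andFb.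
rewrite addrA mulrDr; congr (_ + h * _); apply: eq_bigr => j /andP[jk jk1].
rewrite -val_eqE /= in jk; rewrite -val_eqE /= in jk1.
by rewrite eqSS (negbTE jk) (negbTE jk1).
Qed.

(** Trajectories decouple into single steps, because the momentum relations
    already contain the Euler-Lagrange equations at the interior points: v_k is
    given both by the step which ends at x_k and by the step which starts
    there, and equating the two shows that the sum of the two partial
    gradients at x_k vanishes. *)
Lemma integrator_equivalent_step (fs : seq (state R N -> state R N))
    (mid : state R N -> 'cV[R]_(1 + N)) :
  (forall s m q, pos s != 0 ->
     exists g, has_grad (fun p => L p m q h) (Defs.point s) g) ->
  (forall s p m, pos s != 0 ->
     exists g, has_grad (fun q => L p m q h) (Defs.point s) g) ->
  (forall s m s', pos s != 0 -> pos s' != 0 -> collision_free fs s ->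
     variational_step s m s' <-> s' = compose fs s /\ m = mid s) ->
  integrator_equivalent L h fs.
Proof.
move=> diffl diffr stepP K s spos sfree.
have {}stepP k m : (k < K)%N ->
    variational_step (s k) m (s k.+1) <->
    s k.+1 = compose fs (s k) /\ m = mid (s k).
  by move=> kK; apply: stepP; [exact: spos (ltnW kK)|exact: spos|exact: sfree].
pose x k := Defs.point (s k).
have midP m k : (k < K)%N ->
    stationary (fun y => action L h K x [eta m with k |-> y]) (m k)
    <-> stationary (fun y => L (x k) y (x k.+1) h) (m k).
  move=> kK; have [c cE] := action_midpoint K x m k kK.
  by rewrite (funext cE); exact: stationary_affine.
split=> [[m [[_ mstat] mom]] k kK|sE].
  have [mom0 mom1] := mom k kK.
  have [] // := (stepP k (m k) kK).1; split=> //.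
  by apply/midP => //; exact: mstat.
have step k : (k < K)%N -> variational_step (s k) (mid (s k)) (s k.+1).
  by move=> kK; apply/stepP => //; split=> //; exact: sE.
exists (fun k => mid (s k)); split; last by move=> k /step [].
split=> [[//|k] /= kK|k kK]; last first.
  by apply/(midP (fun k => mid (s k))) => //; case: (step k kK).
have [c cE] := action_point K x (fun k => mid (s k)) k kK.
rewrite (funext cE); apply/stationary_affine/stationaryE.
have [_ _ momr] := step k (ltnW kK); have [_ moml _] := step k.+1 kK.
have kpos : pos (s k.+1) != 0 by apply: spos; exact: ltnW.
have [gr Gr] := diffr (s k.+1) (Defs.point (s k)) (mid (s k)) kpos.
have [gl Gl] := diffl (s k.+1) (mid (s k.+1)) (Defs.point (s k.+2)) kpos.
have := has_gradD Gr Gl.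
suff -> : gr + gl = 0 by [].
(* Both expressions for v_{k+1} contain the same - A(x_{k+1}). *)
move: momr; rewrite moml (grad_unique Gr) (grad_unique Gl) => /addIr /eqP.
by rewrite scaleNr eq_sym -addr_eq0 -scalerDr scaler_eq0 (negbTE h0) => /eqP.
Qed.
End Trajectories.

(** * One step of the variational integrators *)

Section Steps.
Context {R : realType} {N : nat}.
Context (h : R) (h0 : h != 0).

(** The intermediate point, as a function of the state at its left end: the
    end of the first half drift, with time advanced by half of the kick. *)
Definition mid_star_first (s : state R N) : 'cV[R]_(1 + N) :=
  let s' := drift ((h / 2) *: vel s) s in
  spacetime (time s + h / 2 * gam s') (pos s').

(** The momentum relation at x_n says that m is reached by the first half drift,
    so that the potential is differentiable at m as soon as that drift ends off
    the origin;
    stationarity at m says that the elapsed times of both halves agree and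
    that the velocity jumps by the kick; the momentum relation at x_{n+1} then
    is the second half drift. *)
Lemma star_first_step (s s' : state R N) (m : 'cV[R]_(1 + N)) :
  pos (drift ((h / 2) *: vel s) s) != 0 ->
  variational_step (@L2nd_star_first R N) h s m s' <->
  s' = (let r := flow_t h (drift ((h / 2) *: vel s) s) in
        drift ((h / 2) *: vel r) r)
  /\ m = mid_star_first s.
Proof.
case: s s' => t0 x0 g0 u0 [t1 x1 g1 u1].
case: (spacetimeP m) => tm [xm ->] {m}.
rewrite /variational_step /mid_star_first /momentum /Defs.point /=.
rewrite (grad_unique (star_first_grad_p h h0 _ _ _ _ _ _)).
rewrite (grad_unique (star_first_grad_q h h0 _ _ _ _ _ _)) !spacetimeE.
move=> xm0.
split=> [[mstat /spacetime_inj [g0E u0E] /spacetime_inj [g1E u1E]]|].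
  have xmE : xm = x0 + (h / 2) *: u0.
    by apply/colP => i; rewrite u0E !mxE; field.
  rewrite -xmE in xm0 *.
  move/stationaryE: mstat.
  move/(has_grad_unique (star_first_grad_m h h0 t0 tm t1 x0 xm x1 xm0)).
  rewrite spacetime0 => /spacetime_inj [Et Ex].
  have t1E : t1 = tm + (tm - t0).
    apply/eqP; rewrite -subr_eq0 opprD addrA; move/eqP: Et.
    by rewrite mulf_eq0 mulf_eq0 pnatr_eq0 invr_eq0 expf_eq0 /= (negbTE h0).
  have g0E' : g0 = 2 / h * (tm - t0) + phi xm - phi x0.
    by rewrite -[g0]opprK g0E; field.
  have g1E' : g1 = 2 / h * (t1 - tm) + phi xm - phi x1.
    by rewrite -[g1]opprK g1E; field.
  have x1E : x1 = xm + (xm - x0) - (h / 2 * (t1 - t0)) *: grad (@phi R N) xm.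
    (* Up to sign, h^2/2 is the inverse of the coefficient of x1 in the
       vanishing gradient [Ex]. *)
    apply/colP => i; move/colP: Ex => /(_ i); rewrite !mxE => Ei.
    by rewrite -[LHS]addr0 -(mulr0 (h ^+ 2 / 2)) -Ei; field; exact: h0.
  have u1E' : u1 = u0 - (t1 - t0) *: grad (@phi R N) xm.
    by rewrite u1E u0E x1E; apply/colP => i; rewrite !mxE; field.
  have hg : h * (g0 - (phi xm - phi x0)) = t1 - t0.
    by rewrite g0E' t1E; field.
  rewrite hg -u1E'.
  have x1E' : xm + (h / 2) *: u1 = x1.
    by rewrite u1E' u0E x1E; apply/colP => i; rewrite !mxE; field.
  rewrite x1E'; split; last by congr spacetime; rewrite g0E'; field.
  congr State; last by rewrite g1E' g0E' t1E; field.
  by rewrite addrC subrK.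
case=> [[t1E x1E g1E u1E]] /spacetime_inj [tmE xmE].
rewrite -xmE in xm0 t1E x1E g1E u1E tmE *.
rewrite -u1E in x1E g1E; rewrite -x1E in g1E.
split; last 2 first.
- congr spacetime; first by rewrite tmE; field.
  by apply/colP => i; rewrite xmE !mxE; field.
- congr spacetime; first by rewrite g1E t1E tmE; field.
  by apply/colP => i; rewrite x1E !mxE; field.
apply/stationaryE.
have := star_first_grad_m h h0 t0 tm t1 x0 xm x1 xm0; rewrite spacetime0.
congr has_grad; congr spacetime; first by rewrite t1E tmE; field.
apply/colP => i; rewrite x1E u1E t1E; move: (grad _ xm) => G.
by rewrite xmE !mxE; field; exact: h0.
Qed.

Definition mid_first_star (s : state R N) : 'cV[R]_(1 + N) :=
  let s' := flow_t (h / 2) s in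
  spacetime (time s') (pos s' + (h / 2) *: vel s').

(** The momentum relation at x_n says that m is reached by a half kick followed
    by a half drift; stationarity at m says that the velocity is the same in
    both halves and that gam changes by the difference of phi; the momentum
    relation at x_{n+1} then is the second half kick. *)
Lemma first_star_step (s s' : state R N) (m : 'cV[R]_(1 + N)) :
  pos s != 0 -> pos s' != 0 ->
  variational_step (@L2nd_first_star R N) h s m s' <->
  s' = (let r := flow_t (h / 2) s in flow_t (h / 2) (drift (h *: vel r) r))
  /\ m = mid_first_star s.
Proof.
case: s s' => t0 x0 g0 u0 [t1 x1 g1 u1] /= x00 x10.
case: (spacetimeP m) => tm [xm ->] {m}.
rewrite /variational_step /mid_first_star /momentum /Defs.point /=.
rewrite (grad_unique (first_star_grad_p h h0 _ _ _ _ _ _ x00)).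
rewrite (grad_unique (first_star_grad_q h h0 _ _ _ _ _ _ x10)) !spacetimeE.
have gradm := first_star_grad_m h h0 t0 tm t1 x0 xm x1.
split=> [[mstat /spacetime_inj [g0E u0E] /spacetime_inj [g1E u1E]]|].
  have g0E' : g0 = 2 / h * (tm - t0) by rewrite -[g0]opprK g0E; field.
  have g1E' : g1 = 2 / h * (t1 - tm) by rewrite -[g1]opprK g1E; field.
  have tmE : t0 + h / 2 * g0 = tm by rewrite g0E'; field.
  have hg : h / 2 * g0 = tm - t0 by rewrite -tmE addrC addKr.
  have xmE : xm = x0 + (h / 2) *: (u0 - (tm - t0) *: grad (@phi R N) x0).
    by apply/colP => i; rewrite u0E !mxE; field.
  move/stationaryE: mstat => /(has_grad_unique gradm).
  rewrite spacetime0 => /spacetime_inj [Et Ex].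
  have x1E : x1 = xm + (xm - x0).
    apply/colP => i; move/colP: Ex => /(_ i); rewrite !mxE => Ei.
    (* As in [star_first_step], h^2/2 normalises the coefficient of x1. *)
    by rewrite -[LHS]addr0 -(mulr0 (h ^+ 2 / 2)) -Ei; field.
  have g1E2 : g1 = g0 - (phi x1 - phi x0).
    by rewrite -[RHS]addr0 -(mulr0 h) -Et g1E' g0E'; field.
  have x1E' : x0 + h *: (u0 - (tm - t0) *: grad (@phi R N) x0) = x1.
    by rewrite x1E xmE; apply/colP => i; rewrite !mxE; field.
  rewrite tmE hg x1E' -g1E2 xmE; split=> //.
  congr State; first by rewrite g1E'; field.
  apply/colP => i; rewrite u1E g1E'; move: (grad _ x1) => G.
  by rewrite x1E xmE !mxE; field.
case=> [[t1E x1E g1E u1E]] /spacetime_inj [tmE xmE].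
rewrite -x1E in t1E g1E u1E; rewrite -g1E -tmE in t1E u1E.
split; last 2 first.
- congr spacetime; first by rewrite tmE; field.
  by apply/colP => i; rewrite xmE tmE !mxE; field.
- congr spacetime; first by rewrite t1E; field.
  apply/colP => i; rewrite u1E t1E; move: (grad _ x1) => G.
  by rewrite x1E xmE !mxE; field.
apply/stationaryE; move: gradm; rewrite spacetime0.
congr has_grad; congr spacetime; first by rewrite t1E g1E tmE; field.
by apply/colP => i; rewrite x1E xmE !mxE; field.
Qed.
End Steps.

Theorem theorem3p7 (R : realType) (n : nat) (h : R) (h_neq0 : h != 0) :
  integrator_equivalent (@L2nd_star_first R n.+1) h (@Phi2nd_xtx R n.+1 h) /\
  integrator_equivalent (@L2nd_first_star R n.+1) h (@Phi2nd_txt R n h).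
Proof.
split.
  apply: (integrator_equivalent_step _ _ h_neq0 _ (mid_star_first h)).
  - case=> t x g u m q _; have [tm [xm ->]] := spacetimeP m.
    have [t1 [x1 ->]] := spacetimeP q.
    by eexists; apply: star_first_grad_p.
  - case=> t x g u p m _; have [tm [xm ->]] := spacetimeP m.
    have [t0 [x0 ->]] := spacetimeP p.
    by eexists; apply: star_first_grad_q.
  move=> s m s' _ _ sfree; rewrite compose_xtx; apply: star_first_step => //.
  (* The point where the kick takes place is one of the states met on the way,
     the one left after dropping the second sweep and the kick. *)
  pose sweep := [seq @flow_x R n.+1 (h / 2) i | i <- enum 'I_n.+1].
  have := sfree (size (rev sweep)).+1.
  rewrite /Phi2nd_xtx size_cat /= addnS ltnS leq_addr.
  rewrite -cat_rcons drop_size_cat ?size_rcons // compose_full_sweep.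
  by apply.
apply: (integrator_equivalent_step _ _ h_neq0 _ (mid_first_star h)).
- case=> t x g u m q x0; have [tm [xm ->]] := spacetimeP m.
  have [t1 [x1 ->]] := spacetimeP q.
  by eexists; apply: first_star_grad_p.
- case=> t x g u p m x0; have [tm [xm ->]] := spacetimeP m.
  have [t0 [x0' ->]] := spacetimeP p.
  by eexists; apply: first_star_grad_q.
by move=> s m s' s0 s'0 _; rewrite compose_txt; exact: first_star_step.
Qed.
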